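(* There exists a function $\nu:\mathbb{N}\to(0,+\infty)$ such that for every positive integer $n$, every integral polyhedron $P\subseteq\mathbb{R}^n$ whose interior contains an integer point contains a centrally symmetric convex body of volume $\nu(n)$ whose only integer point is its center.
   Context: A polyhedron $P$ is integral if $P=\operatorname{conv}(P\cap\mathbb{Z}^n)$. A convex body is a closed, convex, bounded subset of $\mathbb{R}^n$ with nonempty interior. A set $C$ is centrally symmetric with respect to $x\in C$ (its center) if for every $y\in\mathbb{R}^n$, $x+y\in C$ iff $x-y\in C$. Volume is $n$-dimensional Lebesgue measure. *)

(* Defs.v *)
From HB Require Import structures.
From mathcomp Require Import all_boot all_order all_algebra.
From mathcomp Require Import all_classical all_reals all_analysis.
Set Implicit Arguments. Unset Strict Implicit. Unset Printing Implicit Defensive.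
Import Order.TTheory GRing.Theory Num.Theory.
Import numFieldNormedType.Exports.
Local Open Scope classical_set_scope.
Local Open Scope ring_scope.

Section Defs.
Variables (R : realType) (n : nat).
Local Notation V := 'rV[R]_n.

Definition is_int_point (x : V) : Prop := forall i : 'I_n, x 0 i \is a Num.int.
Definition int_points : set V := [set x | is_int_point x].

Definition conv (S : set V) : set V :=
  [set x | exists (k : nat) (c : 'I_k -> R) (v : 'I_k -> V),
     [/\ (forall i, 0 <= c i), \sum_(i < k) c i = 1,
         (forall i, S (v i)) & x = \sum_(i < k) c i *: v i]].

Definition polyhedron (P : set V) : Prop :=
  exists (m : nat) (A : 'M[R]_(n, m)) (b : 'rV[R]_m),
    P = [set x | forall j : 'I_m, (x *m A) 0 j <= b 0 j].

Definition integral_polyhedron (P : set V) : Prop :=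
  polyhedron P /\ P = conv (P `&` int_points).

Definition convex_set (C : set V) : Prop :=
  forall x y (t : R), C x -> C y -> 0 <= t <= 1 -> C (t *: x + (1 - t) *: y).

Definition convex_body (C : set V) : Prop :=
  [/\ closed C, convex_set C, bounded_set C & (interior C) !=set0].

Definition centrally_symmetric (C : set V) (x : V) : Prop :=
  C x /\ forall y : V, C (x + y) <-> C (x - y).

(** n-dimensional Lebesgue (outer) measure: infimum of the total volume of
    countable covers by closed axis-parallel boxes *)
Definition box (a b : V) : set V := [set x | forall i, a 0 i <= x 0 i <= b 0 i].
Definition box_vol (a b : V) : R := \prod_(i < n) Num.max (b 0 i - a 0 i) 0.
Definition volume (A : set V) : \bar R :=
  ereal_inf [set s | exists (a b : nat -> V),
     A `<=` \bigcup_k box (a k) (b k) /\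
     s = (\sum_(0 <= k <oo) (box_vol (a k) (b k))%:E)%E].
End Defs.

(* Main.v *)
(**
Around an interior integer point z, a bounded number of integer points v_i of P
have z as a combination with positive weights and span the whole space affinely
(Caratheodory applied to small perturbations of z).  Among all positive weights g
with sum 1 and sum_i g_i v_i integral, take one almost maximizing prod_i g_i.  If
some weights were tiny compared to the others, Dirichlet's theorem would give q and
integers m_i with q g_i - m_i small; replacing g by g + (q g - m) keeps the
combination integral, at least doubles the tiny weights and hardly changes the
others, so it would increase the product.  Hence all weights are at least some
d = d(n), and x = sum_i g_i v_i satisfies x +- d (v_i - x) in P.  Among the bases W
of integer vectors w with x +- d w in P choose one with |det W| minimal: then the
parallelepiped x + {sum_i c_i w_i : |c_i| <= s}, s small, meets Z^n only in x.  The
parallelepiped spanned by W contains representatives of R^n / Z^n, so its volume is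
at least 1, and rescaling it yields the prescribed volume.
*)
Require Import Defs.
From HB Require Import structures.
From mathcomp Require Import all_boot all_order all_algebra.
From mathcomp Require Import all_classical all_reals all_analysis.
From mathcomp Require Import ring lra zify.
Import Order.TTheory GRing.Theory Num.Theory.
Import numFieldNormedType.Exports.
Local Open Scope classical_set_scope.
Local Open Scope ring_scope.

(** * Simultaneous Diophantine approximation *)

Lemma intr_norm_lt1 {R : realType} (m : int) : `|m%:~R : R| < 1 -> m = 0.
Proof. by rewrite -intr_norm ltrz1; lia. Qed.

(** Pigeonhole: cutting the fractional parts into [N] intervals per coordinate gives [N ^ #|I|]
    cells for [N ^ #|I| + 1] multiples of [g], so two multiples share a cell and [q] is their
    difference. *)
Lemma dirichlet {R : realType} {I : finType} (N : nat) (g : I -> R) :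
  (0 < N)%N ->
  exists (q : nat) (m : I -> int), (0 < q <= N ^ #|I|)%N /\
    forall i, `|q%:R * g i - (m i)%:~R| < N%:R^-1.
Proof.
move=> N0.
pose fr (x : R) := x - (Num.floor x)%:~R.
have fr0 x : 0 <= fr x < 1.
  by have := floor_itv x; rewrite /fr intrD => /andP[]; lra.
(* [inord] needs a type of the form ['I_k.+1]; [N.-1.+1] is [N] because [0 < N]. *)
pose bk (x : R) : 'I_N.-1.+1 := inord `|Num.floor (N%:R * fr x)|%N.
have bkE x : ((bk x)%:R : R) <= N%:R * fr x < (bk x)%:R + 1.
  have [f0 f1] := andP (fr0 x).
  have y0 : 0 <= N%:R * fr x by rewrite mulr_ge0.
  have yN : N%:R * fr x < N%:R by rewrite -[ltRHS]mulr1 ltr_pM2l // ltr0n.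
  have fl0 : 0 <= Num.floor (N%:R * fr x) by rewrite floor_ge0.
  have flN : (`|Num.floor (N%:R * fr x)| < N)%N.
    by rewrite -ltz_nat gez0_abs // -(ltr_int R) (le_lt_trans (floor_le_tmp _)).
  rewrite /bk inordK ?prednK //.
  by have := floor_itv (N%:R * fr x); rewrite intrD -(gez0_abs fl0).
pose f (a : 'I_(N ^ #|I|).+1) := [ffun i => bk (a%:R * g i)].
have /injectivePn[a [b]] : ~~ injectiveb f.
  apply/negP => /injectiveP/leq_card.
  by rewrite card_ord card_ffun card_ord prednK // ltnn.
wlog ab : a b / (a < b)%N.
  move=> H ne fE; have [lt|lt|e] := ltngtP a b; first exact: (H a b).
  - by apply: (H b a) => //; rewrite eq_sym.
  - by move: ne; rewrite -(inj_eq val_inj) /= e eqxx.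
move=> _ fE.
exists (b - a)%N, (fun i => Num.floor (b%:R * g i) - Num.floor (a%:R * g i)); split.
  by rewrite subn_gt0 ab /= (leq_trans (leq_subr _ _)) // -ltnS.
move=> i; have /ffunP/(_ i) := fE; rewrite !ffunE => e.
have := bkE (a%:R * g i); have := bkE (b%:R * g i); rewrite -e => /andP[b1 b2] /andP[a1 a2].
rewrite natrB ?(ltnW ab) // intrB.
have -> : (b%:R - a%:R) * g i - ((Num.floor (b%:R * g i))%:~R - (Num.floor (a%:R * g i))%:~R)
  = fr (b%:R * g i) - fr (a%:R * g i) by rewrite /fr; ring.
have N0' : 0 < (N%:R : R) by rewrite ltr0n.
rewrite -(ltr_pM2l N0') mulfV ?gt_eqF // -{1}(gtr0_norm N0') -normrM mulrBr.
by rewrite ltr_norml; apply/andP; split; lra.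
Qed.

Lemma bernoulli_sub {R : realType} (x : R) (k : nat) :
  0 <= x <= 1 -> 1 - k%:R * x <= (1 - x) ^+ k.
Proof.
move=> /andP[x0 x1]; elim: k => [|k IH]; first by rewrite mul0r subr0 expr0.
rewrite exprS -natr1.
have h : (1 - x) * (1 - k%:R * x) <= (1 - x) * (1 - x) ^+ k.
  by rewrite ler_wpM2l // subr_ge0.
apply: le_trans h; have : 0 <= k%:R * (x * x) :> R by rewrite !mulr_ge0.
nra.
Qed.

(** * Weights with integral barycenter and their balancing *)

Definition integral_weights {R : realType} {n : nat} {I : finType}
    (v : I -> 'rV[R]_n) (g : I -> R) :=
  [/\ forall i, 0 < g i, \sum_i g i = 1 & is_int_point (\sum_i g i *: v i)].

Lemma int_point_comb {R : realType} {n : nat} {I : finType}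
    (v : I -> 'rV[R]_n) (c : I -> R) :
  (forall i, is_int_point (v i)) -> (forall i, c i \is a Num.int) ->
  is_int_point (\sum_i c i *: v i).
Proof.
by move=> hv hc j; rewrite summxE; apply: rpred_sum => i _; rewrite mxE rpredM ?hc ?hv. 
Qed.

Lemma int_pointB {R : realType} {n : nat} (x y : 'rV[R]_n) :
  is_int_point x -> is_int_point y -> is_int_point (x - y).
Proof. by move=> hx hy j; rewrite !mxE rpredB ?hx ?hy. Qed.

Lemma int_pointD {R : realType} {n : nat} (x y : 'rV[R]_n) :
  is_int_point x -> is_int_point y -> is_int_point (x + y).
Proof. by move=> hx hy j; rewrite !mxE rpredD ?hx ?hy. Qed.

(* The multiplier 3 / 2 comes from 2 * (1 - 1 / (4 k)) ^ k: one weight doubles, the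
   others lose at most a fraction 1 / (4 k). *)
Lemma integral_weights_increase {R : realType} (I : finType) (d : R) :
  0 < d <= 1 ->
  exists e : R, 0 < e <= 1 /\
  forall (n : nat) (v : I -> 'rV[R]_n) (g : I -> R),
    (forall i, is_int_point (v i)) -> integral_weights v g ->
    (forall i, g i < e \/ d <= g i) -> (exists i, g i < e) ->
    exists2 g', integral_weights v g' & 3 / 2 * \prod_i g i <= \prod_i g' i.
Proof.
move=> /andP[d0 d1].
pose k := #|I|.
(* With [r = 1 / N], a shift by [r] costs a weight that is at least [d] less than the fraction
   [1 / (4 * k.+1)] of itself. *)
have [N hN] : exists N : nat, 4 * k.+1%:R / d < N%:R.
  by exists (Num.bound (4 * k.+1%:R / d)); apply: archi_boundP; rewrite divr_ge0 ?mulr_ge0 // ltW.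
have kd0 : 4 * k.+1%:R / d > 0 by rewrite divr_gt0 // mulr_gt0.
have N0 : (0 < N)%N by rewrite -(ltr0n R) (lt_trans kd0).
have N0' : 0 < N%:R :> R by rewrite ltr0n.
have k0 : 0 < k.+1%:R :> R by [].
have k1 : 1 <= k.+1%:R :> R by rewrite ler1n.
pose r : R := N%:R^-1.
have r0 : 0 < r by rewrite invr_gt0.
have hr : r * (4 * k.+1%:R) < d.
  by rewrite /r mulrC ltr_pdivrMr // [ltRHS]mulrC -ltr_pdivrMr.
pose Q : R := (N ^ k)%:R.
have Q1 : 1 <= Q by rewrite ler1n expn_gt0 N0.
(* Since [q <= Q], a weight below [1 / (4 * Q)] has [q * g i < 1 / 4], so its rounding [m i] is 0
   and the weight is multiplied by [q + 1 >= 2]. *)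
exists (4 * Q)^-1; split.
  by rewrite invr_gt0 invf_le1; lra.
move=> n v g vint [gpos gsum gint] dich [i0 gi0].
have [q [m [/andP[q0 qQ] qm]]] := dirichlet N g N0.
have q1' : 1 <= q%:R :> R by rewrite ler1n.
have qQ' : q%:R <= Q by rewrite ler_nat.
have small i : g i < (4 * Q)^-1 -> m i = 0.
  move=> gi; apply: (@intr_norm_lt1 R).
  have h1 : q%:R * g i <= 1 / 4.
    have: Q * g i <= 1/4.
      by move: gi; rewrite -[X in _ < X]mul1r ltr_pdivlMr; lra.
    by apply: le_trans; rewrite ler_wpM2r // ltW.
  have h0 : 0 <= q%:R * g i by rewrite mulr_ge0 // ltW.
  by have := qm i; rewrite -/r !ltr_norml => /andP[? ?]; apply/andP; split; nra.
(* The rounding errors add up to less than 1 while [q] minus the sum of the [m i] is an integer, so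
   the new weights still sum to 1. *)
have msum : \sum_i (m i)%:~R = q%:R :> R.
  have : q%:~R - \sum_i m i = 0.
    apply: (@intr_norm_lt1 R).
    have -> : (q%:~R - \sum_i m i)%:~R = \sum_i (q%:R * g i - (m i)%:~R) :> R.
      by rewrite big_split /= -mulr_sumr gsum mulr1 sumrN intrB rmorph_sum /= intz.
    apply: le_lt_trans (ler_norm_sum _ _ _) _.
    apply: (@le_lt_trans _ _ (\sum_(i : I) r)).
      by apply: ler_sum => i _; apply: ltW; exact: qm.
    rewrite sumr_const -mulr_natl.
    have : (#|I|%:R : R) <= k.+1%:R by rewrite ler_nat.
    by nra.
  move=> /(congr1 (fun z : int => z%:~R : R)); rewrite intrB rmorph_sum /= intz.
  by move=> /eqP; rewrite subr_eq0 => /eqP <-.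
have [y [y0 y1 yk yd]] : exists y : R, [/\ 0 <= y, y <= 1 / 4, k%:R * y <= 1 / 4 & r <= y * d].
  exists (4 * k.+1%:R)^-1; have k4 : 0 < 4 * k.+1%:R :> R by rewrite mulr_gt0.
  split; last by rewrite mulrC ler_pdivlMr // ltW.
  - by rewrite ltW ?invr_gt0.
  - rewrite -[leLHS]mul1r ler_pdivrMr //; lra.
  - rewrite ler_pdivrMr // -[k.+1%:R]natr1; lra.
pose c i : R := if g i < (4 * Q)^-1 then 2 else 1 - y.
pose g' i := g i + q%:R * g i - (m i)%:~R.
have cg i : c i * g i <= g' i.
  rewrite /c /g'; case: ifPn => [/small -> | h].
    by rewrite subr0; have := gpos i; nra.
  have {}h : d <= g i by case: (dich i) => // h'; rewrite h' in h.
  have : r <= y * g i by apply: le_trans yd _; rewrite ler_wpM2l.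
  by have := qm i; rewrite -/r !ltr_norml => /andP[]; lra.
have cpos i : 1 - y <= c i by rewrite /c; case: ifP => _; lra.
exists g'.
  split=> [i||].
  - by apply: lt_le_trans (cg i); rewrite mulr_gt0 //; apply: lt_le_trans (cpos i); lra.
  - by rewrite /g' big_split big_split /= sumrN -mulr_sumr gsum msum mulr1 addrK.
  - have -> : \sum_i g' i *: v i = \sum_i g i *: v i +
       (q%:R *: \sum_i g i *: v i - \sum_i (m i)%:~R *: v i).
      rewrite scaler_sumr -sumrB -big_split /=; apply: eq_bigr => i _.
      by rewrite scalerA -scalerBl -scalerDl /g' addrA.
    apply: int_pointD => //; apply: int_pointB; last exact: int_point_comb.
    by move=> j; rewrite mxE rpredM // ?natr_int.
apply: (@le_trans _ _ (\prod_i (c i * g i))); last first.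
  apply: ler_prod => i _; rewrite cg andbT mulr_ge0 ?(ltW (gpos i)) //.
  by apply: le_trans (cpos i); lra.
rewrite big_split /= ler_wpM2r ?prodr_ge0 // => [i _|]; first exact: ltW.
rewrite (bigD1 i0) //= {1}/c gi0.
have : (1 - y) ^+ k <= \prod_(i | i != i0) c i.
  apply: (@le_trans _ _ (\prod_(i | i != i0) (1 - y : R))).
    rewrite prodr_const ler_wiXn2l //; try lra.
    by rewrite max_card.
  by apply: ler_prod => i _; rewrite cpos andbT; lra.
have : 0 <= y <= 1 by apply/andP; split; lra.
move=> /(bernoulli_sub y k).
lra.
Qed.

(** For nearly maximal weights the previous lemma forbids a gap: if some weight is below [t r.+1],
    some weight lies in [[t r.+1, t r)]. Hence each threshold is reached by more weights than the
    one before, until all reach it, after at most [#|I|] steps. *)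
Lemma integral_weights_balanced {R : realType} (I : finType) :
  exists2 d : R, 0 < d &
  forall (n : nat) (v : I -> 'rV[R]_n) (g : I -> R),
    (forall i, is_int_point (v i)) -> integral_weights v g ->
    exists2 g', integral_weights v g' & forall i, d <= g' i.
Proof.
have /choice[E HE] (d : R) : exists e, 0 < d <= 1 -> 0 < e <= 1 /\
  forall (n : nat) (v : I -> 'rV[R]_n) (g : I -> R),
    (forall i, is_int_point (v i)) -> integral_weights v g ->
    (forall i, g i < e \/ d <= g i) -> (exists i, g i < e) ->
    exists2 g', integral_weights v g' & 3 / 2 * \prod_i g i <= \prod_i g' i.
  have [h|h] := boolP (0 < d <= 1); last by exists 0.
  by have [e he] := integral_weights_increase I d h; exists e.
(* Weights of sum 1 cannot all lie below [1 / (#|I| + 1)], so the first threshold is reached by one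
   of them. *)
pose t r := iter r E #|I|.+1%:R^-1.
have t01 r : 0 < t r <= 1.
  elim: r => [|r IH] /=; last by have [] := HE _ IH.
  by rewrite invr_gt0 ltr0n /= invf_le1 ?ltr0n // ler1n.
exists (t #|I|); first by have /andP[] := t01 #|I|.
move=> n v g vint gw.
pose S := [set \prod_i h i | h in [set h | @integral_weights R n I v h]].
have Sg : S (\prod_i g i) by exists g.
have Sub : has_ubound S.
  exists 1 => _ [h [h0 h1 _] <-]; apply: (@le_trans _ _ (\prod_(i : I) 1)); last by rewrite big1_eq.
  apply: ler_prod => i _; rewrite ltW //= -h1 (bigD1 i) //= lerDl.
  by apply: sumr_ge0 => j _; exact: ltW.
have Sup : has_sup S by split => //; exists (\prod_i g i).
have s0 : 0 < sup S.
  apply: lt_le_trans (ub_le_sup Sub Sg).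
  by apply: prodr_gt0 => i _; case: gw.
(* The product of [h] exceeds 2/3 of the supremum, so a further factor 3/2 is impossible. *)
have [_ [h hw <-] hS] : exists2 e, S e & sup S - sup S / 3 < e.
  by apply: sup_adherent => //; rewrite divr_gt0.
exists h => // i.
have noinc h' : integral_weights v h' -> ~ (3 / 2 * \prod_i h i <= \prod_i h' i).
  move=> hw' le.
  have : \prod_i h' i <= sup S by apply: ub_le_sup => //; exists h'.
  lra.
have key r : (forall i, t r <= h i) \/ (r < #|[set i | (t r <= h i)%R]%SET|)%N.
  elim: r => [|r IH].
    right; rewrite card_gt0; apply/negP => /eqP/setP e0.
    case: hw => _ + _; apply/eqP; rewrite lt_eqF //.
    apply: (@le_lt_trans _ _ (\sum_(i : I) #|I|.+1%:R^-1)).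
      by apply: ler_sum => j _; have := e0 j; rewrite !inE => /negbT; rewrite -ltNge => /ltW.
    by rewrite sumr_const -(mulr_natl (_^-1)) ltr_pdivrMr ?ltr0n // mul1r ltr_nat.
  have [h1|h1] := pselect (forall i, t r.+1 <= h i); [by left|right].
  have [_ H] := HE _ (t01 r).
  have [j /andP[j1 j2]] : exists j, t r.+1 <= h j < t r.
    apply: contrapT => /forallNP nj.
    have [||h' hw' le] := H n v h vint hw; last exact: (noinc h' hw').
    - move=> j; case: (ltP (h j) (t r.+1)) => [|le]; [by left|right].
      by rewrite leNgt; apply/negP => lt; apply: (nj j); rewrite lt andbT.
    - by move/existsNP: h1 => [j /negP]; rewrite -ltNge; exists j.
  case: IH => [/(_ j)|IH]; first by rewrite leNgt j2.
  apply: leq_trans (proper_card _); first exact: IH.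
  apply/properP; split; last by exists j; rewrite !inE // -ltNge.
  apply/fintype.subsetP => l; rewrite !inE; apply: le_trans.
  by apply: ltW; apply: le_lt_trans j1 j2.
by case: (key #|I|) => // ; rewrite ltnNge max_card.
Qed.

(** * Convex combinations in polyhedra and weights around an interior point *)

Lemma polyhedron_conv {R : realType} {n : nat} (P : set 'rV[R]_n) {I : finType}
    (c : I -> R) (v : I -> 'rV[R]_n) :
  polyhedron P -> (forall i, 0 <= c i) -> \sum_i c i = 1 ->
  (forall i, P (v i)) -> P (\sum_i c i *: v i).
Proof.
move=> [m [A [b ->]]] c0 c1 Pv j.
rewrite mulmx_suml summxE -[leRHS]mul1r -c1 mulr_suml.
by apply: ler_sum => i _; rewrite -scalemxAl mxE ler_wpM2l //; exact: Pv.
Qed.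

(** Having both [x + u i] and [x - u i] in [P] bounds the change of each constraint along [u i] by
    its slack at [x]; [n] coefficients of size at most [1 / n] use up at most that slack. *)
Lemma polyhedron_symmetric {R : realType} {n : nat} (P : set 'rV[R]_n)
    (x : 'rV[R]_n) (u : 'I_n -> 'rV[R]_n) (c : 'I_n -> R) :
  (0 < n)%N -> polyhedron P ->
  (forall i, P (x + u i) /\ P (x - u i)) -> (forall i, `|c i| <= n%:R^-1) ->
  P (x + \sum_i c i *: u i).
Proof.
move=> n0 [m [A [b ->]]] Pu hc j.
have n0' : n%:R != 0 :> R by rewrite pnatr_eq0 -lt0n.
have hu i : `|(u i *m A) 0 j| <= b 0 j - (x *m A) 0 j.
  have [/(_ j) + /(_ j)] := Pu i; rewrite mulmxDl mulmxBl !mxE.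
  by rewrite ler_norml => ? ?; apply/andP; split; lra.
rewrite mulmxDl mulmx_suml mxE summxE -lerBrDl.
have -> : b 0 j - (x *m A) 0 j = \sum_(i < n) n%:R^-1 * (b 0 j - (x *m A) 0 j).
  by rewrite sumr_const card_ord -mulrnAl -[_^-1 *+ _]mulr_natr mulVf // mul1r.
apply: ler_sum => i _; rewrite -scalemxAl mxE.
by apply: le_trans (ler_norm _) _; rewrite normrM ler_pM.
Qed.

(** In a representation with the fewest points, more than [n.+1] points would have an affine
    dependency that removes one. Padding to exactly [n.+1] makes the index type depend on [n] alone,
    and so the later constants. *)
Lemma caratheodory {R : realType} {n : nat} (S : set 'rV[R]_n) (x : 'rV[R]_n) :
  Defs.conv S x ->
  exists (c : 'I_n.+1 -> R) (v : 'I_n.+1 -> 'rV[R]_n),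
    [/\ forall i, 0 <= c i, \sum_i c i = 1, forall i, S (v i)
      & x = \sum_i c i *: v i].
Proof.
pose rep k := `[< exists (c : 'I_k -> R) (v : 'I_k -> 'rV[R]_n),
  [/\ forall i, 0 <= c i, \sum_i c i = 1, forall i, S (v i)
      & x = \sum_i c i *: v i] >].
move=> [k hk].
have ex : exists k, rep k by exists k; apply/asboolP.
case: (ex_minnP ex) => {hk ex}k /asboolP[c [v [c0 c1 Sv xE]]] kmin.
have k0 : (0 < k)%N.
  by case: k c {v Sv kmin c0 xE} c1 => // c; rewrite big_ord0 => /esym/eqP; rewrite oner_eq0.
have kn : (k <= n.+1)%N.
  rewrite leqNgt; apply/negP => nk.
  (* The extra column of ones turns a kernel vector into an affine dependency, with coefficients of
     sum 0. *)
  pose A : 'M[R]_(k, n + 1) := \matrix_i row_mx (v i) 1%:M.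
  have : kermx A != 0.
    rewrite kermx_eq0 /row_free neq_ltn; apply/orP; left.
    by apply: leq_ltn_trans (rank_leq_col A) _; rewrite addn1.
  move=> /rowV0Pn[u /sub_kermxP uA unz].
  wlog [i1 ui1] : u uA unz / exists i, 0 < u 0 i.
    move=> H; have [h|h] := pselect (exists i, 0 < u 0 i); first exact: (H u).
    apply: (H (- u)); rewrite ?mulNmx ?uA ?oppr0 ?oppr_eq0 //.
    have [i ui] : exists i, u 0 i != 0.
      apply: contrapT => /forallNP h'; move/eqP: unz; apply; apply/rowP => i.
      by have /negP := h' i; rewrite negbK mxE => /eqP.
    exists i; rewrite mxE oppr_gt0 lt_neqAle ui /= leNgt.
    by apply/negP => ui'; apply: h; exists i.
  have uE : \sum_i u 0 i *: row_mx (v i) (1%:M : 'M[R]_1) = 0.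
    by move: uA; rewrite mulmx_sum_row; under eq_bigr do rewrite rowK.
  have uv : \sum_i u 0 i *: v i = 0.
    have := congr1 lsubmx uE; rewrite linear_sum linear0 => E0; rewrite -[RHS]E0.
    by apply: eq_bigr => i _; rewrite linearZ /= row_mxKl.
  have u1 : \sum_i u 0 i = 0.
    have := congr1 (fun M => rsubmx M 0 0) uE; rewrite linear_sum linear0 mxE summxE => E0; rewrite -[RHS]E0.
    by apply: eq_bigr => i _; rewrite linearZ /= row_mxKr !mxE mulr1.
  (* Subtracting the multiple of [u] given by the smallest ratio kills the coefficient at [i0] and
     keeps the others nonnegative. *)
  have [i0 ui0 imin] : exists2 i0, 0 < u 0 i0 &
      forall i, 0 < u 0 i -> c i0 / u 0 i0 <= c i / u 0 i.
    by case: (@arg_minP _ R _ i1 (fun i => 0 < u 0 i) (fun i => c i / u 0 i) ui1) => i0 ? ?; exists i0.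
  pose t := c i0 / u 0 i0.
  have t0 : 0 <= t by rewrite divr_ge0 // ltW.
  pose c' i := c i - t * u 0 i.
  have c'0 i : 0 <= c' i.
    rewrite subr_ge0; have [ui|ui] := ltP 0 (u 0 i).
      by rewrite -ler_pdivlMr //; exact: imin.
    by apply: le_trans (c0 i); rewrite mulr_ge0_le0.
  have c'i0 : c' i0 = 0 by rewrite /c' /t divfK ?subrr // gt_eqF.
  have [k' kE] : exists k', k = k'.+1 by exists k.-1; rewrite prednK.
  subst k.
  suff /kmin : rep k' by rewrite ltnn.
  apply/asboolP; exists (c' \o lift i0), (v \o lift i0); split => //=.
  - have <- : \sum_i c' i = \sum_i c' (lift i0 i) by rewrite (bigD1_ord i0) //= c'i0 add0r.
    by rewrite /c' sumrB c1 -mulr_sumr u1 mulr0 subr0.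
  - have <- : \sum_i c' i *: v i = \sum_i c' (lift i0 i) *: v (lift i0 i).
      by rewrite (bigD1_ord i0) //= c'i0 scale0r add0r.
    have -> : x = x - t *: \sum_i u 0 i *: v i by rewrite uv scaler0 subr0.
    rewrite {1}xE scaler_sumr -sumrB; apply: eq_bigr => i _.
    by rewrite scalerA -scalerBl.
(* Padding: indices from [k] on get coefficient 0 and repeat a point already used, so that
   membership in [S] holds. *)
pose cc i := if insub i is Some j then c j else 0.
pose vv i := if insub i is Some j then v j else v (Ordinal k0).
have ccE (i : 'I_k) : cc i = c i by rewrite /cc valK.
have vvE (i : 'I_k) : vv i = v i by rewrite /vv valK.
have cc0 i : ~~ (i < k)%N -> cc i = 0 by move=> h; rewrite /cc insubN.
exists (fun i => cc i), (fun i => vv i); split.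
- by move=> i; rewrite /cc; case: insubP.
- rewrite -c1 (eq_bigr (fun i : 'I_k => cc i)) => [|i _]; last by rewrite ccE.
  rewrite (big_ord_widen _ cc kn) [RHS]big_mkcond; apply: eq_bigr => i _.
  by case: ifPn => // /cc0.
- by move=> i; rewrite /vv; case: insubP.
- rewrite xE (eq_bigr (fun i : 'I_k => cc i *: vv i)) => [|i _]; last by rewrite ccE vvE.
  rewrite (big_ord_widen _ (fun i => cc i *: vv i) kn) big_mkcond; apply: eq_bigr => i _.
  by case: ifPn => // /cc0 ->; rewrite scale0r.
Qed.

(** Caratheodory is applied to the [2 n] points obtained by moving [z] by [e] in both directions
    along each axis: they average to [z] and their differences span. The rank is stated for every
    [x] because the barycenter is fixed only after balancing. *)
Lemma interior_int_point_weights {R : realType} {n : nat} (P : set 'rV[R]_n) (z : 'rV[R]_n) :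
  (0 < n)%N -> P = Defs.conv (P `&` int_points (n := n)) -> is_int_point z -> interior P z ->
  exists (v : 'I_n * bool * 'I_n.+1 -> 'rV[R]_n) (g : 'I_n * bool * 'I_n.+1 -> R),
    [/\ forall l, P (v l), forall l, is_int_point (v l), integral_weights v g
      & forall x, row_full (\matrix_(l < #|{: 'I_n * bool * 'I_n.+1}|) (v (enum_val l) - x))].
Proof.
move=> n0 PE zint Pz.
have [e e0 he] : exists2 e : R, 0 < e &
    forall (i : 'I_n) (b : bool), P (z + ((-1) ^+ b * e) *: delta_mx 0 i).
  move: Pz; rewrite /interior => /nbhs_ballP[e /= e0 he].
  exists (e / 2) => [|i b]; first by rewrite divr_gt0.
  apply: he; split => // i' j; rewrite /ball /= !mxE opprD addrA subrr sub0r normrN !normrM.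
  rewrite normr_sign mul1r; apply: (@le_lt_trans _ _ (e / 2)); last by lra.
  have e2 : 0 <= e / 2 by rewrite divr_ge0 // ltW.
  rewrite -(normrM e) (ger0_norm e2) ler_piMr //.
  by case: (_ && _); rewrite ?normr1 ?normr0.
have Pz0 : P z by exact: interior_subset Pz.
have /choice[F HF] (ib : 'I_n * bool) : exists cv : ('I_n.+1 -> R) * ('I_n.+1 -> 'rV[R]_n),
    [/\ forall i, 0 <= cv.1 i, \sum_i cv.1 i = 1,
        forall i, P (cv.2 i) /\ is_int_point (cv.2 i)
      & z + ((-1) ^+ ib.2 * e) *: delta_mx 0 ib.1 = \sum_i cv.1 i *: cv.2 i].
  have := he ib.1 ib.2; rewrite {1}PE => /caratheodory[c [v [? ? ? ?]]].
  by exists (c, v); split.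
pose c l := (F l.1).1 l.2.
(* A point of weight zero is replaced by z, which can carry any weight. *)
pose v l := if c l == 0 then z else (F l.1).2 l.2.
have c0 l : 0 <= c l by case: (HF l.1) => + _ _ _; exact.
have c1 ib : \sum_j c (ib, j) = 1 by case: (HF ib).
have cv ib x : \sum_j c (ib, j) *: (v (ib, j) - x) =
    z + ((-1) ^+ ib.2 * e) *: delta_mx 0 ib.1 - x.
  have [_ _ _ ->] := HF ib.
  rewrite -[x in RHS]scale1r -(c1 ib) scaler_suml -sumrB; apply: eq_bigr => j _.
  rewrite scalerBr; congr (_ - _); rewrite /v.
  by case: eqP => //= h; rewrite -[X in _ = X *: _]/(c (ib, j)) h !scale0r.
pose a l := if c l == 0 then 1 else c l.
have a0 l : 0 < a l by rewrite /a; case: eqVneq => // h; rewrite lt_neqAle eq_sym h c0.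
pose K := \sum_l a l.
have K0 : 0 < K.
  rewrite /K (bigD1 (Ordinal n0, true, ord0)) //= ltr_pwDl // sumr_ge0 // => l _.
  exact: ltW.
exists v, (fun l => a l / K); split.
- by move=> l; rewrite /v; case: eqP => // _; case: (HF l.1) => _ _ /(_ l.2)[].
- by move=> l; rewrite /v; case: eqP => // _; case: (HF l.1) => _ _ /(_ l.2)[].
- have s1 : \sum_l a l / K = 1 by rewrite -mulr_suml divff // gt_eqF.
  split => // [l|]; first by rewrite divr_gt0.
  suff -> : \sum_l (a l / K) *: v l = z by exact: zint.
  apply/eqP; rewrite -subr_eq0 -[z in _ - z]scale1r -s1 scaler_suml -sumrB.
  (* Relative to [z] the dummy points contribute nothing, so [c] may stand for [a]; then the
     opposite perturbations cancel. *)
  apply/eqP; transitivity (K^-1 *: \sum_l c l *: (v l - z)).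
    rewrite scaler_sumr; apply: eq_bigr => l _; rewrite -scalerBr [in RHS]scalerA mulrC.
    by rewrite /a /v; case: eqP => // ->; rewrite subrr !scaler0.
  have -> : \sum_l c l *: (v l - z) = \sum_ib \sum_j c (ib, j) *: (v (ib, j) - z).
    by rewrite pair_big; apply: eq_bigr => -[].
  under eq_bigr => ib _ do rewrite cv addrC addKr.
  have -> : \sum_(ib : 'I_n * bool) ((-1) ^+ ib.2 * e) *: delta_mx 0 ib.1 =
      \sum_(i < n) \sum_(b : bool) ((-1) ^+ b * e) *: delta_mx 0 i :> 'rV[R]_n.
    by rewrite pair_big; apply: eq_bigr => -[].
  rewrite big1 ?scaler0 // => i _; rewrite big_bool /= -scalerDl expr1 expr0.
  by rewrite -mulrDl addNr mul0r scale0r.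
move=> x; set T := (X in row_full X).
have vT l : (v l - x <= T)%MS.
  have -> : v l - x = row (enum_rank l) T by rewrite rowK enum_rankK.
  exact: row_sub.
rewrite -sub1mx; apply/row_subP => i.
(* Both combinations have total weight 1, so [x] cancels and the difference is [2 * e] times the
   unit vector. *)
have -> : row i 1%:M = (2 * e)^-1 *:
    (\sum_j c (i, false, j) *: (v (i, false, j) - x)
     - \sum_j c (i, true, j) *: (v (i, true, j) - x)).
  rewrite !cv /= expr0 expr1 rowE mulmx1 mul1r mulN1r scaleNr.
  set w := e *: _.
  have -> : z + w - x - (z - w - x) = w + w.
    by rewrite !opprD !opprK !addrA; rewrite [z + w - x - z]addrAC [z + w - z]addrAC subrr add0r addrAC addrNK.
  rewrite -scalerDl (_ : e + e = 2 * e); last by ring.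
  by rewrite scalerA mulVf ?scale1r // gt_eqF // mulr_gt0.
apply: scalemx_sub; apply: addmx_sub; last rewrite eqmx_opp.
  by apply: summx_sub => j _; exact: scalemx_sub.
by apply: summx_sub => j _; exact: scalemx_sub.
Qed.

(** * Inscribed integral bases and the minimal determinant *)

Definition inscribed_basis {R : realType} {n : nat} (P : set 'rV[R]_n) (d : R)
    (x : 'rV[R]_n) (W : 'M[R]_n) :=
  W \in unitmx /\ forall i, [/\ is_int_point (row i W),
    P (x + d *: row i W) & P (x - d *: row i W)].

(** The point [x + s *: (v l - x)] has weights [g i * (1 - s)], plus [s] at [i = l]. They are
    nonnegative for [s = d] by [d <= 1] and for [s = - d] by [d <= g l]. A basis is then selected
    among the differences [v l - x]. *)
Lemma inscribed_basis_exists {R : realType} (n : nat) : (0 < n)%N ->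
  exists2 d : R, 0 < d <= 1 &
  forall P : set 'rV[R]_n, integral_polyhedron P ->
    (exists z, is_int_point z /\ interior P z) ->
    exists x W, is_int_point x /\ inscribed_basis P d x W.
Proof.
move=> n0; have [e e0 He] := @integral_weights_balanced R ('I_n * bool * 'I_n.+1)%type.
exists (Num.min e 1); first by rewrite lt_min e0 ltr01 ge_min lexx orbT.
set d := Num.min e 1.
have d0 : 0 < d by rewrite lt_min e0 ltr01.
have d1 : d <= 1 by rewrite ge_min lexx orbT.
have de : d <= e by rewrite ge_min lexx.
move=> P [polyP PE] [z [zint Pz]].
have [v [g [Pv vint gw full]]] := interior_int_point_weights P z n0 PE zint Pz.
have [{gw}g [gpos g1 xint] ge] := He n v g vint gw.
set x := \sum_i g i *: v i in xint.
have Pbal l : P (x + d *: (v l - x)) /\ P (x - d *: (v l - x)).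
  have sE s : x + s *: (v l - x) = \sum_i (g i * (1 - s) + s * (i == l)%:R) *: v i.
    under eq_bigr => i _ do rewrite scalerDl mulrC -!scalerA.
    rewrite big_split /= -!scaler_sumr -/x (bigD1 l) //= eqxx scale1r.
    rewrite big1 => [|i /negbTE->]; last by rewrite scale0r.
    by rewrite addr0 scalerBl scale1r scalerBr addrAC addrA.
  have s1 s : \sum_i (g i * (1 - s) + s * (i == l)%:R) = 1.
    rewrite big_split /= -mulr_suml g1 (bigD1 l) //= eqxx mulr1.
    rewrite big1 => [|i /negbTE->]; last by rewrite mulr0.
    by rewrite mul1r addr0 subrK.
  rewrite -scaleNr !sE; split; apply: polyhedron_conv => //; move=> i.
    by rewrite addr_ge0 // mulr_ge0 ?subr_ge0 //; exact: ltW.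
  have gd := le_trans de (ge i); have gi := ltW (gpos i).
  by rewrite opprK; case: eqP => _ /=; nra.
exists x, (rowsub (fullrankfun (full x)) (\matrix_l (v (enum_val l) - x))).
split => //; split; first exact: fullrowsub_unit.
move=> i; set l := enum_val (fullrankfun (full x) i).
have -> : row i (rowsub (fullrankfun (full x)) (\matrix_l (v (enum_val l) - x))) = v l - x.
  by rewrite row_rowsub rowK.
by have [? ?] := Pbal l; split => //; exact: int_pointB.
Qed.

(** The modified matrix is [E *m W], with [E] the identity whose row [i] is replaced by [c];
    expanding [\det E] along that row meets only cofactors of the identity. *)
Lemma det_replace_row {R : comPzRingType} {n : nat} (W : 'M[R]_n) (c : 'rV[R]_n) (i : 'I_n) :
  \det (\matrix_k (if k == i then c *m W else row k W)) = c 0 i * \det W.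
Proof.
pose E : 'M[R]_n := \matrix_k (if k == i then c else row k 1%:M).
have -> : \matrix_k (if k == i then c *m W else row k W) = E *m W.
  apply/row_matrixP => k; rewrite row_mul !rowK; case: eqP => // _.
  by rewrite -row_mul mul1mx.
rewrite det_mulmx; congr (_ * _).
rewrite (expand_det_row _ i) (bigD1 i) //=.
have cofE j : cofactor E i j = (i == j)%:R.
  have -> : cofactor E i j = cofactor 1%:M i j.
    congr (_ * \det _); apply/matrixP => a b; rewrite !mxE.
    by rewrite eq_sym (negbTE (neq_lift _ _)) !mxE.
  have := mul_mx_adj (1%:M : 'M[R]_n); rewrite mul1mx det1 => /matrixP/(_ j i).
  by rewrite !mxE eq_sym => ->.
rewrite cofE eqxx mulr1 big1 => [|j ji]; last by rewrite cofE eq_sym (negbTE ji) mulr0.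
by rewrite addr0 mxE eqxx.
Qed.

Lemma det_int_rows {R : realType} {n : nat} (W : 'M[R]_n) :
  (forall i, is_int_point (row i W)) -> \det W \is a Num.int.
Proof.
move=> Wint.
have Wij i j : W i j \is a Num.int by have := Wint i j; rewrite mxE.
rewrite /determinant; apply: rpred_sum => s _; rewrite rpredM ?rpredX ?rpredN1 //.
by apply: rpred_prod => i _; exact: Wij.
Qed.

(* Minimality of |det W| makes the small integer combinations trivial: putting
   such a combination in place of the i-th row multiplies the determinant by c_i. *)
Lemma inscribed_basis_reduced {R : realType} {n : nat} (P : set 'rV[R]_n)
    (d : R) (x : 'rV[R]_n) (W0 : 'M[R]_n) :
  (0 < n)%N -> polyhedron P -> inscribed_basis P d x W0 ->
  exists2 W, inscribed_basis P d x W &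
    forall c : 'rV[R]_n, (forall i, `|c 0 i| < 1) -> (forall i, `|c 0 i| <= n%:R^-1) ->
      is_int_point (c *m W) -> c = 0.
Proof.
move=> n0 polyP bW0.
(* Integral bases have integer determinants, so a least absolute value exists. *)
pose q k := `[< exists2 W, inscribed_basis P d x W & `|\det W| = k%:R >].
have detnat W : inscribed_basis P d x W -> exists k : nat, `|\det W| = k%:R.
  move=> [_ hW]; have /intrP[m ->] := det_int_rows W (fun i => let: And3 a _ _ := hW i in a).
  by exists `|m|%N; rewrite -intr_norm -abszE.
have exq : exists k, q k.
  by have [k hk] := detnat _ bW0; exists k; apply/asboolP; exists W0.
case: (ex_minnP exq) => k /asboolP[W bW detW] kmin.
exists W => // c c1 cn cint; apply/rowP => i; rewrite [RHS]mxE; apply/eqP.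
apply: contrapT => /negP ci.
pose W' := \matrix_k (if k == i then c *m W else row k W).
have [uW hW] := bW.
(* A nonzero [c 0 i] keeps the matrix invertible, and coefficients of size at most [1 / n] keep the
   new row inscribed. *)
have bW' : inscribed_basis P d x W'.
  split; first by rewrite unitmxE det_replace_row unitrM -unitmxE uW unitfE ci.
  move=> j; rewrite rowK; case: eqP => // _.
  have hP j' : P (x + d *: row j' W) /\ P (x - d *: row j' W) by case: (hW j').
  rewrite mulmx_sum_row -scalerN -sumrN !scaler_sumr; split; first by rewrite -mulmx_sum_row.
  - under eq_bigr => j' _ do rewrite scalerA mulrC -scalerA.
    exact: polyhedron_symmetric.
  - under eq_bigr => j' _ do rewrite -scaleNr scalerA mulrC -scalerA.
    by apply: polyhedron_symmetric => // j'; rewrite normrN.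
have [k' hk'] := detnat _ bW'.
have /kmin : q k' by apply/asboolP; exists W'.
rewrite leqNgt => /negP; apply; rewrite -(ltr_nat R) -hk' -detW det_replace_row normrM.
by rewrite gtr_pMl ?c1 // normr_gt0 -unitfE -unitmxE.
Qed.

(** * Continuity of affine maps and compactness of parallelepipeds *)

Lemma rV_continuous_coord {R : realType} {n : nat} (f : 'rV[R]_n -> 'rV[R]_n) :
  (forall j, continuous (fun y => f y 0 j)) -> continuous f.
Proof.
move=> fc x A [Q Qn QA].
have H : \forall y \near x, forall j, Q 0 j (f y 0 j).
  apply: (@filter_forall _ _ (fun j y => Q 0 j (f y 0 j)) _ (nbhs_filter x)) => j; exact: (fc j x _ (Qn 0 j)).
change (nbhs x (f @^-1` A)); apply: (filterS _ H) => y Qy; apply: QA => i j; rewrite ord1; exact: Qy.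
Qed.

Lemma sum_continuous {R : realType} {T : topologicalType} {I : Type} (s : seq I)
    (F : I -> T -> R) :
  (forall i, continuous (F i)) -> continuous (fun y => \sum_(i <- s) F i y).
Proof.
move=> cF; elim: s => [|i s IH].
  have -> : (fun y => \sum_(i <- [::]) F i y) = (fun=> 0) by apply/funext => y; rewrite big_nil.
  by move=> y; exact: cvg_cst.
have -> : (fun y => \sum_(j <- i :: s) F j y) = (fun y => F i y + \sum_(j <- s) F j y).
  by apply/funext => y; rewrite big_cons.
move=> y; exact: (@cvgD _ _ _ _ _ (F i) (fun y => \sum_(i <- s) F i y) _ _ (cF i y) (IH y)).
Qed.

Lemma affine_continuous {R : realType} {n : nat} (x : 'rV[R]_n) (W : 'M[R]_n) :
  continuous (fun c : 'rV[R]_n => x + c *m W).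
Proof.
apply: rV_continuous_coord => j.
have -> : (fun c : 'rV[R]_n => (x + c *m W) 0 j) =
    (fun c => x 0 j + \sum_i c 0 i * W i j) by apply/funext => c'; rewrite !mxE.
move=> c; apply: (@cvgD _ _ _ _ (nbhs_filter c) (fun=> x 0 j) _ _ _ (cvg_cst _)).
refine (@sum_continuous R _ _ _ (fun i (c : 'rV[R]_n) => c 0 i * W i j) _ c) => i y.
exact: (@cvgM _ _ _ (nbhs_filter y) (fun c : 'rV[R]_n => c 0 i) (fun=> W i j) _ _
  (@coord_continuous _ _ _ 0 i y) (cvg_cst _)).
Qed.

Lemma compact_box {R : realType} {n : nat} (a b : 'rV[R]_n) : compact (box a b).
Proof.
have -> : box a b = [set v : 'rV[R]_n | forall i, `[a 0 i, b 0 i]%classic (v 0 i)].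
  by apply/seteqP; split => v /= h i; have := h i; rewrite /= in_itv.
by apply: (@rV_compact _ _ (fun i => `[a 0 i, b 0 i]%classic)) => i; exact: segment_compact.
Qed.

Definition parallelepiped {R : realType} {n : nat} (W : 'M[R]_n) : set 'rV[R]_n :=
  [set c *m W | c in box 0 (const_mx 1)].

Lemma compact_parallelepiped {R : realType} {n : nat} (W : 'M[R]_n) :
  compact (parallelepiped W).
Proof.
have cW : continuous (fun c : 'rV[R]_n => c *m W).
  have -> : (fun c : 'rV[R]_n => c *m W) = (fun c => 0 + c *m W).
    by apply/funext => c; rewrite add0r.
  exact: affine_continuous.
exact: (@continuous_compact _ _ _ _ (continuous_subspaceT cW) (@compact_box R n 0 (const_mx 1))).
Qed.

(** * Volume: scaling and finiteness *)

Lemma box_vol_ge0 {R : realType} {n : nat} (a b : 'rV[R]_n) : 0 <= box_vol a b.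
Proof. by apply: prodr_ge0 => i _; rewrite le_max lexx orbT. Qed.

Lemma volume_affine_le {R : realType} {n : nat} (a : 'rV[R]_n) (t : R) (A : set 'rV[R]_n) :
  0 < t -> (volume [set (a + t *: y)%R | y in A] <= (t ^+ n)%:E * volume A)%E.
Proof.
move=> t0; rewrite /volume -ereal_inf_pZl ?exprn_gt0 //.
apply: ereal_inf_le_tmp => _ [s [u [v [Auv ->]]] <-].
exists (fun k => a + t *: u k), (fun k => a + t *: v k); split.
  move=> _ [y /Auv[k _ uv] <-]; exists k => // i; rewrite !mxE !lerD2l !ler_pM2l //.
rewrite -nneseriesZl => [|k _]; last by rewrite lee_fin box_vol_ge0.
apply: eq_eseriesr => k _; rewrite -EFinM; congr EFin.
have -> : t ^+ n = \prod_(i < n) t by rewrite prodr_const card_ord.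
rewrite /box_vol -big_split.
apply: eq_bigr => i _; rewrite !mxE /= maxr_pMr ?ltW // mulr0; congr Num.max; ring.
Qed.

(** The reverse inequality is the previous lemma applied to the inverse homothety. *)
Lemma volume_affine {R : realType} {n : nat} (a : 'rV[R]_n) (t : R) (A : set 'rV[R]_n) :
  0 < t -> volume [set a + t *: y | y in A] = ((t ^+ n)%:E * volume A)%E.
Proof.
move=> t0; apply/eqP; rewrite eq_le volume_affine_le //=.
have tn0 : 0 < t ^+ n by rewrite exprn_gt0.
have AE : A = [set - (t^-1 *: a) + t^-1 *: y | y in [set a + t *: y | y in A]].
  have inv y : - (t^-1 *: a) + t^-1 *: (a + t *: y) = y.
    by rewrite scalerDr addKr scalerA mulVf ?scale1r // gt_eqF.
  apply/seteqP; split => [y Ay|_ [_ [y Ay <-] <-]]; last by rewrite inv.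
  by exists (a + t *: y) => //; exists y.
rewrite {1}AE; apply: le_trans (lee_wpmul2l _ (volume_affine_le _ _ _ _)) _.
- by rewrite lee_fin ltW.
- by rewrite invr_gt0.
by rewrite muleA -EFinM exprVn mulfV ?mul1e // gt_eqF.
Qed.

Lemma volume_lt_pinfty {R : realType} {n : nat} (A : set 'rV[R]_n) :
  (0 < n)%N -> compact A -> (volume A < +oo)%E.
Proof.
move=> n0 /compact_bounded[M [_ hM]].
pose K := `|M| + 1.
have AK y : A y -> box (const_mx (- K)) (const_mx K) y.
  move=> Ay i; rewrite !mxE -ler_norml.
  have /hM/(_ y Ay) : M < K by rewrite /K (le_lt_trans (ler_norm _)) // ltrDl.
  apply: le_trans; rewrite [leRHS]/Num.Def.normr /= mx_normrE.
  by apply/bigmax_geP; right => /=; exists (0, i).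
apply: (@le_lt_trans _ _ (box_vol (const_mx (- K) : 'rV[R]_n) (const_mx K))%:E); last exact: ltry.
apply: ereal_inf_lbound.
(* All boxes after the first are the single point 0, of volume zero because [0 < n]. *)
exists (fun k => if k == 0%N then const_mx (- K) else 0), (fun k => if k == 0%N then const_mx K else 0).
split; first by move=> y /AK hy; exists 0%N.
rewrite (nneseries_split 0 1) => [|k _]; last by rewrite lee_fin box_vol_ge0.
rewrite big_nat1 /= eseries0 ?adde0 // => -[//|k] _ _ /=.
rewrite /box_vol (bigD1 (Ordinal n0)) //= !mxE subrr maxxx mul0r //.
Qed.

(** * Lower bound for the volume of integral parallelepipeds *)

Lemma prod_perturb {R : realType} {I : finType} (m : I -> R) (e : R) :
  (forall i, 0 <= m i) -> 0 < e ->
  exists2 h, 0 < h & \prod_i (m i + h) <= \prod_i m i + e.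
Proof.
move=> m0 e0.
(* A bound linear in [h] on [[0, 1]] passes through induction over the factors. *)
suff [C C0 HC] : exists2 C, 0 <= C &
    forall h, 0 <= h <= 1 -> \prod_i (m i + h) <= \prod_i m i + C * h.
  have C1 : 0 < C + 1 by rewrite ltr_wpDl.
  exists (Num.min 1 (e / (C + 1))); first by rewrite lt_min ltr01 divr_gt0.
  set h := Num.min _ _.
  have h0 : 0 <= h by rewrite le_min ler01 divr_ge0 // ltW.
  apply: le_trans (HC h _) _; first by rewrite h0 ge_min lexx.
  have : h <= e / (C + 1) by rewrite ge_min lexx orbT.
  by rewrite ler_pdivlMr // => ?; rewrite lerD2l; nra.
elim: (index_enum I) => [|i s [C C0 HC]].
  by exists 0 => // h _; rewrite !big_nil mul0r addr0.
have P0 : 0 <= \prod_(j <- s) m j by apply: prodr_ge0.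
exists (\prod_(j <- s) m j + (m i + 1) * C).
  by rewrite addr_ge0 // mulr_ge0 // addr_ge0.
move=> h h01; rewrite !big_cons; have := HC h h01; have /andP[h0 h1] := h01.
move: (\prod_(j <- s) m j) (\prod_(j <- s) (m j + h)) P0 => p p' p0 pp'.
have : (m i + h) * p' <= (m i + h) * (p + C * h) by rewrite ler_wpM2l ?addr_ge0.
have : 0 <= C * h * (1 - h) by rewrite !mulr_ge0 // subr_ge0.
lra.
Qed.

Lemma card_le_prod {T : finType} {n : nat} (A : {set T}) (L : 'I_n -> nat) (e : T -> 'I_n -> nat) :
  (forall x i, x \in A -> (e x i < L i)%N) ->
  (forall x y, x \in A -> y \in A -> (forall i, e x i = e y i) -> x = y) ->
  (#|A| <= \prod_i L i)%N.
Proof.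
move=> eL einj; pose M := \max_i L i.
pose f x : {ffun 'I_n -> 'I_M.+1} := [ffun i => inord (e x i)].
pose F i : pred 'I_M.+1 := fun j => (j < L i)%N.
have eM x i : x \in A -> (e x i < M.+1)%N.
  by move=> /(eL _ i)/leq_trans; apply; apply: leqW; exact: leq_bigmax.
have finj : {in A &, injective f}.
  move=> x y xA yA /ffunP fxy; apply: einj => // i.
  by have := fxy i; rewrite !ffunE => /(congr1 val); rewrite /= !inordK ?eM.
rewrite -(card_in_imset finj); apply: (@leq_trans #|family F|).
  apply/subset_leq_card/fintype.subsetP => _ /imsetP[x xA ->].
  by apply/familyP => i; rewrite ffunE unfold_in /F inordK ?eM ?eL.
rewrite card_family foldrE big_map big_enum /=; apply: leq_prod => i _.
rewrite cardE -(size_map val) -[leqRHS](size_iota 0).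
apply: uniq_leq_size; first by rewrite (map_inj_uniq val_inj) enum_uniq.
by move=> _ /mapP[j + ->]; rewrite mem_enum mem_iota unfold_in.
Qed.

Lemma eq_of_congr (N x y : nat) (d : int) :
  x%:Z - y%:Z = N%:Z * d -> (x < N)%N -> (y < N)%N -> x = y.
Proof.
move=> e xN yN; have d0 : d = 0 by nia.
by move: e; rewrite d0; lia.
Qed.

(** Taking fractional parts of the coordinates of [y] in the basis [W] subtracts an integer
    combination of integer rows. *)
Lemma parallelepiped_lattice_rep {R : realType} {n : nat} (W : 'M[R]_n) (y : 'rV[R]_n) :
  W \in unitmx -> (forall i, is_int_point (row i W)) ->
  exists u : 'I_n -> int, parallelepiped W (y - \row_i (u i)%:~R).
Proof.
move=> uW Wint; have [c ->] : exists c, y = c *m W by exists (y *m invmx W); rewrite mulmxKV.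
pose f : 'rV[R]_n := \row_i (Num.floor (c 0 i))%:~R.
have fint : is_int_point (f *m W).
  rewrite mulmx_sum_row; apply: int_point_comb => // i.
  by rewrite mxE intr_int.
exists (fun i => Num.floor ((f *m W) 0 i)).
have -> : \row_i (Num.floor ((f *m W) 0 i))%:~R = f *m W.
  by apply/rowP => i; rewrite [LHS]mxE; apply/eqP; rewrite -intrEfloor; exact: fint.
exists (c - f); last by rewrite mulmxBl.
move=> i; rewrite !mxE.
by have := floor_itv (c 0 i); rewrite intrD => /andP[? ?]; apply/andP; split; lra.
Qed.

(* Counts the N^n points of (1/N)Z^n modulo Z^n, each of which has a
   representative in the parallelepiped and hence in one of the boxes. *)
Lemma parallelepiped_finite_cover {R : realType} {n : nat} (W : 'M[R]_n) (K : nat)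
    (a b : nat -> 'rV[R]_n) (h : nat -> R) :
  W \in unitmx -> (forall i, is_int_point (row i W)) -> (forall k, 0 < h k) ->
  (forall y, parallelepiped W y -> exists k : 'I_K,
     forall i, a k 0 i - h k < y 0 i < b k 0 i + h k) ->
  1 <= \sum_(k < K) \prod_i (Num.max (b k 0 i - a k 0 i) 0 + 3 * h k).
Proof.
move=> uW Wint h0 cov.
pose m k i := Num.max (b k 0 i - a k 0 i) 0.
have m0 k i : 0 <= m k i by rewrite le_max lexx orbT.
have mba k i : b k 0 i - a k 0 i <= m k i by rewrite le_max lexx.
(* The mesh [1 / N] is at most every margin [h k]; the unit lost by rounding up a count is then at
   most [N * h k], which turns [2 * h k] into [3 * h k]. *)
pose N := (\max_(k < K) Num.bound (h k)^-1).+1.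
have N0 : 0 < N%:R :> R by rewrite ltr0n.
have Nh (k : 'I_K) : 1 <= N%:R * h k.
  rewrite -ler_pdivrMr // mul1r; apply: ltW; apply: lt_le_trans (_ : (Num.bound (h k)^-1)%:R <= _).
    by apply: archi_boundP; rewrite invr_ge0 ltW.
  by rewrite ler_nat; apply: leqW; exact: (leq_bigmax k).
clearbody N.
have /choice[ku kuP] (g : {ffun 'I_n -> 'I_N}) : exists ku : 'I_K * ('I_n -> int),
    forall i, a ku.1 0 i - h ku.1 < (g i)%:R / N%:R - (ku.2 i)%:~R < b ku.1 0 i + h ku.1.
  have [u /cov[k ku]] := @parallelepiped_lattice_rep R n W (\row_i ((g i)%:R / N%:R)) uW Wint.
  by exists (k, u) => i /=; have := ku i; rewrite !mxE.
pose base (k : 'I_K) i := Num.floor (N%:R * (a k 0 i - h k)).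
(* [H g i] numbers the translated grid point within its box, in units of [1 / N] from the lower
   edge. That edge is excluded, hence the [- 1] to start from 0. *)
pose H (g : {ffun 'I_n -> 'I_N}) i : int := (g i)%:Z - N%:Z * (ku g).2 i - base (ku g).1 i - 1.
have HE g i : (H g i)%:~R = N%:R * ((g i)%:R / N%:R - ((ku g).2 i)%:~R) - (base (ku g).1 i)%:~R - 1 :> R.
  by rewrite /H !intrB intrM mulrBr mulrCA divff ?mulr1 // gt_eqF.
have H0 g i : 0 <= H g i.
  have /andP[lo _] := kuP g i.
  have /andP[fl _] := floor_itv (N%:R * (a (ku g).1 0 i - h (ku g).1)).
  rewrite -(ltr_pM2l N0) in lo; have := le_lt_trans fl lo.
  rewrite -/(base _ _) -subr_gt0 => pos.
  have : 0 < H g i + 1 by rewrite -(ltr_int R) intrD HE subrK.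
  lia.
have Hlt g i : (H g i)%:~R < N%:R * (m (ku g).1 i + 2 * h (ku g).1).
  have /andP[_ hi] := kuP g i.
  have /andP[_ fl] := floor_itv (N%:R * (a (ku g).1 0 i - h (ku g).1)).
  rewrite -/(base _ _) intrD in fl.
  rewrite HE; move: hi; rewrite -(ltr_pM2l N0) => hi.
  have : N%:R * (b (ku g).1 0 i - a (ku g).1 0 i) <= N%:R * m (ku g).1 i by rewrite ler_pM2l.
  lra.
pose L (k : 'I_K) i := (Num.trunc (N%:R * (m k i + 2 * h k))).+1.
have x0 (k : 'I_K) i : 0 <= N%:R * (m k i + 2 * h k).
  by rewrite mulr_ge0 ?addr_ge0 ?mulr_ge0 // ltW.
have LE (k : 'I_K) i : (L k i)%:R <= N%:R * (m k i + 3 * h k).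
  rewrite /L -natr1; have := truncn_le (N%:R * (m k i + 2 * h k)); rewrite x0.
  by have := Nh k; lra.
have cardA (k : 'I_K) : (#|[set g | (ku g).1 == k]%SET| <= \prod_i L k i)%N.
  apply: (card_le_prod _ _ (fun g i => `|H g i|%N)) => [g i|g g'].
    rewrite inE => /eqP kE; rewrite /L ltnS leqNgt truncn_lt_nat // -leNgt ltW //.
    by have := Hlt g i; rewrite kE -{1}(gez0_abs (H0 g i)).
  rewrite !inE => /eqP kE /eqP kE' eH; apply/ffunP => i; apply: val_inj => /=.
  have : H g i = H g' i.
    by rewrite -(gez0_abs (H0 g i)) -(gez0_abs (H0 g' i)) eH.
  rewrite /H kE kE' => eq.
  (* Same box and same number make [g i] and [g' i] congruent modulo [N], hence equal. *)
  have gg : (g i)%:Z - (g' i)%:Z = N%:Z * ((ku g).2 i - (ku g').2 i).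
    by move: eq => /addIr/addIr/eqP; rewrite subr_eq => /eqP ->; ring.
  by apply: (eq_of_congr _ _ _ _ gg).
have : (N ^ n <= \sum_(k < K) \prod_i L k i)%N.
  have <- : #|{ffun 'I_n -> 'I_N}| = (N ^ n)%N by rewrite card_ffun !card_ord.
  rewrite -sum1_card (partition_big (fun g => (ku g).1) xpredT) //=.
  by apply: leq_sum => k _; rewrite sum1dep_card.
rewrite -(ler_nat R) natrX natr_sum => le1.
have Nn0 : 0 < N%:R ^+ n :> R by rewrite exprn_gt0.
rewrite -(ler_pM2l Nn0) mulr1; apply: le_trans le1 _; rewrite mulr_sumr.
apply: ler_sum => k _; rewrite natr_prod.
have -> : N%:R ^+ n = \prod_(i < n) N%:R :> R by rewrite prodr_const card_ord.
by rewrite -big_split; apply: ler_prod => i _; rewrite LE ler0n.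
Qed.

Lemma open_coord_box {R : realType} {n : nat} (a b : 'rV[R]_n) :
  open [set y : 'rV[R]_n | forall i, a 0 i < y 0 i < b 0 i].
Proof.
rewrite openE => y yab.
exists (fun i j => `]a 0 j, b 0 j[%classic) => [i j|z zab i].
  by apply: open_nbhs_nbhs; split; [exact: interval_open|rewrite /= in_itv /= ord1; exact: yab].
by have := zab 0 i; rewrite /= in_itv.
Qed.

(** The closed boxes of a countable cover are enlarged to open ones at total cost [e]; compactness
    leaves finitely many, to which the counting bound applies. *)
Lemma volume_parallelepiped_ge1 {R : realType} {n : nat} (W : 'M[R]_n) :
  W \in unitmx -> (forall i, is_int_point (row i W)) ->
  (1 <= volume (parallelepiped W))%E.
Proof.
move=> uW Wint; apply: le_ereal_inf_tmp => _ [a [b [cov ->]]].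
apply/lee_addgt0Pr => e e0.
have /choice[h hP] (k : nat) : exists h : R, 0 < h /\
    \prod_i (Num.max (b k 0 i - a k 0 i) 0 + 3 * h)
      <= box_vol (a k) (b k) + e / (2 ^ k.+1)%:R.
  have [||h h0 hle] := @prod_perturb R 'I_n (fun i => Num.max (b k 0 i - a k 0 i) 0)
     (e / (2 ^ k.+1)%:R).
  - by move=> i; rewrite le_max lexx orbT.
  - by rewrite divr_gt0 // ltr0n expn_gt0.
  (* The counting bound adds three margins to each side. *)
  exists (h / 3); rewrite divr_gt0 //; split => //.
  by rewrite mulrC divfK.
pose O k := [set y : 'rV[R]_n | forall i, a k 0 i - h k < y 0 i < b k 0 i + h k].
have Oopen k : open (O k).
  have := @open_coord_box R n (a k - const_mx (h k)) (b k + const_mx (h k)).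
  by congr open; apply/seteqP; split => y /= hy i; have := hy i; rewrite !mxE.
have := @compact_parallelepiped R n W; rewrite compact_cover.
move=> /(_ nat setT O (fun k _ => Oopen k))[|F _ Fcov].
  move=> y /cov[k _ yk]; exists k => // i; have /andP[? ?] := yk i.
  by have [? _] := hP k; apply/andP; split; lra.
pose K := (\max_(k <- finmap.enum_fset F) k).+1.
have covK y : parallelepiped W y -> exists k : 'I_K,
    forall i, a k 0 i - h k < y 0 i < b k 0 i + h k.
  move=> /Fcov[k /= kF yk].
  have kK : (k < K)%N by rewrite ltnS; exact: (leq_bigmax_seq (F := id)).
  by exists (Ordinal kK).
have le1 := @parallelepiped_finite_cover R n W K a b h uW Wint (fun k => (hP k).1) covK.
apply: le_trans (epsilon_trick _ _ (ltW e0)); last first.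
  by move=> k; rewrite lee_fin box_vol_ge0.
apply: le_trans (nneseries_lim_ge K _); last first.
  by move=> k _ _; rewrite -EFinD lee_fin addr_ge0 ?box_vol_ge0 // divr_ge0 // ltW.
rewrite big_mkord; under eq_bigr do rewrite -EFinD.
rewrite sumEFin lee_fin; apply: le_trans le1 _.
by apply: ler_sum => k _; case: (hP k).
Qed.

(** * The centered parallelepiped and the conclusion *)

Definition centered_parallelepiped {R : realType} {n : nat} (x : 'rV[R]_n)
    (W : 'M[R]_n) (s : R) : set 'rV[R]_n :=
  [set x + c *m W | c in box (const_mx (- s)) (const_mx s)].

Lemma box_const {R : realType} {n : nat} (s : R) (c : 'rV[R]_n) :
  box (const_mx (- s)) (const_mx s) c <-> forall i, `|c 0 i| <= s.
Proof. by split=> h i; have := h i; rewrite !mxE ler_norml. Qed.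

(** Doubling, scaling by [s] and shifting by [- s] carries the unit cube of coefficients to the
    centered one; in this form [volume_affine] gives the volume. *)
Lemma centered_parallelepipedE {R : realType} {n : nat} (x : 'rV[R]_n) (W : 'M[R]_n) (s : R) :
  0 < s -> centered_parallelepiped x W s =
  [set x - s *: (const_mx 1 *m W) + (2 * s) *: y | y in parallelepiped W].
Proof.
move=> s0; have s20 : 0 < 2 * s by rewrite mulr_gt0.
have E (c : 'rV[R]_n) : x - s *: (const_mx 1 *m W) + (2 * s) *: (c *m W) =
    x + ((2 * s) *: c - const_mx s) *m W.
  rewrite mulmxBl -!scalemxAl -addrA; congr (_ + _); rewrite addrC; congr (_ - _).
  by rewrite scalemxAl; congr (_ *m _); apply/rowP => i; rewrite !mxE mulr1.
apply/seteqP; split => [_ [c hc <-]|_ [_ [c hc <-] <-]].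
  exists (((2 * s)^-1 *: (c + const_mx s)) *m W).
    exists ((2 * s)^-1 *: (c + const_mx s)) => // i; have := hc i; rewrite !mxE => /andP[? ?].
    by rewrite mulrC ler_pdivlMr // ler_pdivrMr //; apply/andP; split; lra.
  by rewrite E scalerA divff ?scale1r ?addrK // gt_eqF.
rewrite E; exists ((2 * s) *: c - const_mx s) => // i; have := hc i; rewrite !mxE => /andP[? ?].
by apply/andP; split; nra.
Qed.

Lemma centered_parallelepiped_body {R : realType} {n : nat} (x : 'rV[R]_n) (W : 'M[R]_n) (s : R) :
  0 < s -> W \in unitmx -> convex_body (centered_parallelepiped x W s).
Proof.
move=> s0 uW; have cC : compact (centered_parallelepiped x W s).
  exact: (@continuous_compact _ _ _ _ (continuous_subspaceT (affine_continuous x W))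
    (@compact_box R n (const_mx (- s)) (const_mx s))).
split.
- by apply: compact_closed cC; exact: norm_hausdorff.
- move=> _ _ t [c /box_const hc <-] [c' /box_const hc' <-] /andP[t0 t1].
  exists (t *: c + (1 - t) *: c').
    apply/box_const => i; rewrite !mxE; have := hc i; have := hc' i.
    by rewrite !ler_norml => /andP[? ?] /andP[? ?]; apply/andP; split; nra.
  rewrite mulmxDl -!scalemxAl !scalerDr addrACA -scalerDl.
  by rewrite (addrC t) subrK scale1r.
- exact: compact_bounded.
exists x; rewrite /interior.
have : nbhs (0 : 'rV[R]_n) (box (const_mx (- s)) (const_mx s)).
  apply: filterS (_ : nbhs _ [set y : 'rV[R]_n | forall i, (const_mx (- s) : 'rV[R]_n) 0 i < y 0 i < (const_mx s : 'rV[R]_n) 0 i]).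
    by move=> y hy i; have /andP[? ?] := hy i; rewrite !ltW.
  apply: open_nbhs_nbhs; split; first exact: open_coord_box.
  by move=> i; rewrite !mxE oppr_lt0 s0.
(* The inverse of the affine parametrization is continuous and sends [x] to 0, so it pulls the box
   back to a neighborhood of [x]. *)
have x0 : - (x *m invmx W) + x *m invmx W = 0 by rewrite addNr.
rewrite -{1}x0 => /(affine_continuous (- (x *m invmx W)) (invmx W) x).
rewrite nbhs_simpl /=; apply: filterS => y hy; exists (- (x *m invmx W) + y *m invmx W) => //.
by rewrite mulmxDl mulNmx !mulmxKV // addrA subrr add0r.
Qed.

Lemma exists_root {R : realType} (n : nat) (v : R) : (0 < n)%N -> 1 <= v ->
  exists2 r, 1 <= r & r ^+ n = v.
Proof.
move=> n0 v1; have v0 : 0 <= v by apply: le_trans v1.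
have rn : (v `^ n%:R^-1) ^+ n = v.
  by rewrite -powR_mulrn ?powR_ge0 // -powRrM mulVf ?powRr1 // pnatr_eq0 -lt0n.
exists (v `^ n%:R^-1) => //.
by rewrite -(@expr_ge1 _ n) ?powR_ge0 // rn.
Qed.

Lemma exists_symmetric_body {R : realType} (n : nat) : (0 < n)%N ->
  exists2 nu : R, 0 < nu &
  forall P : set 'rV[R]_n, integral_polyhedron P ->
  (exists z, is_int_point z /\ interior P z) ->
  exists (C : set 'rV[R]_n) (x : 'rV[R]_n),
    [/\ C `<=` P, convex_body C, centrally_symmetric C x,
        volume C = nu%:E & C `&` @int_points R n = [set x]].
Proof.
move=> n0; have [d /andP[d0 d1] Hd] := @inscribed_basis_exists R n n0.
have n1 : 1 <= n%:R :> R by rewrite ler1n.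
have n0' : 0 < n%:R :> R by rewrite ltr0n.
have tau0 : 0 < d / n%:R by rewrite divr_gt0.
(* The parallelepiped of [W] has volume [r ^ n] and is scaled by [2 * s = d / (n * r)], so [r]
   cancels. *)
exists ((d / n%:R) ^+ n); first by rewrite exprn_gt0.
move=> P intP zP; have [x [W0 [xint bW0]]] := Hd P intP zP; have [polyP _] := intP.
have [W [uW hW] Wred] := inscribed_basis_reduced P d x W0 n0 polyP bW0.
have Wint i : is_int_point (row i W) by case: (hW i).
have [v v1 volW] : exists2 v : R, 1 <= v & volume (parallelepiped W) = v%:E.
  have := volume_parallelepiped_ge1 W uW Wint.
  have := volume_lt_pinfty _ n0 (compact_parallelepiped W).
  by case: (volume _) => [v| |] //; exists v.
have [r r1 rv] := exists_root n v n0 v1.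
have r0 : 0 < r by apply: lt_le_trans r1.
(* From [1 <= r] follows [s <= d / n], which serves both the inclusion in [P] and the minimality of
   [W]. *)
pose s := d / n%:R / r / 2.
have s0 : 0 < s by rewrite !divr_gt0.
have dn : d / n%:R <= n%:R^-1 by rewrite ler_piMl // invr_ge0 ltW.
have n1' : n%:R^-1 <= 1 :> R by rewrite invf_le1.
have qd : d / n%:R / r <= d / n%:R by rewrite ler_pdivrMr // ler_peMr // ltW.
have sd : s <= d / n%:R by move: s0 qd; rewrite /s; move: (_ / r) => q; lra.
have s1 : s < 1.
  have : d / n%:R / r <= 1 by rewrite (le_trans qd) // (le_trans dn).
  by rewrite /s; move: (_ / r) => q; lra.
exists (centered_parallelepiped x W s), x; split.
- move=> _ [c /box_const hc <-]; rewrite mulmx_sum_row.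
  (* With respect to the inscribed vectors [d *: row i W] the coefficients have size at most
     [s / d <= 1 / n]. *)
  have -> : \sum_i c 0 i *: row i W = \sum_i (c 0 i / d) *: (d *: row i W).
    by apply: eq_bigr => i _; rewrite scalerA divfK // gt_eqF.
  apply: polyhedron_symmetric => // i; first by case: (hW i).
  rewrite normrM normfV (gtr0_norm d0) ler_pdivrMr // mulrC.
  exact: le_trans (hc i) sd.
- exact: centered_parallelepiped_body.
- have mem (c : 'rV[R]_n) : (forall i, `|c 0 i| <= s) -> centered_parallelepiped x W s (x + c *m W).
    by move=> hc; exists c => //; apply/box_const.
  split; first by rewrite -{2}[x]addr0 -(mul0mx _ W); apply: mem => i; rewrite mxE normr0 ltW.
  have sym y : centered_parallelepiped x W s (x + y) -> centered_parallelepiped x W s (x - y).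
    move=> [c /box_const hc /addrI <-]; rewrite -mulNmx; apply: mem => i.
    by rewrite mxE normrN.
  by move=> y; split => [/sym //|/sym]; rewrite opprK.
- rewrite centered_parallelepipedE // (volume_affine _ (2 * s) (parallelepiped W)); last first.
    by rewrite mulr_gt0.
  rewrite volW -EFinM; congr EFin.
  have -> : 2 * s = d / n%:R / r by rewrite /s mulrC divfK.
  by rewrite [X in X * _]exprMn exprVn rv divfK // gt_eqF // (lt_le_trans ltr01).
- apply/seteqP; split => [_ [[c /box_const hc <-] cint]|_ ->]; last first.
    split => //; exists 0; last by rewrite mul0mx addr0.
    by apply/box_const => i; rewrite mxE normr0 ltW.
  rewrite (_ : c = 0) ?mul0mx ?addr0 //; apply: Wred => [i|i|].
  + exact: le_lt_trans (hc i) s1.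
  + exact: le_trans (hc i) (le_trans sd dn).
  + by rewrite -[c *m W](addKr x) addrC; apply: int_pointB.
Qed.

Theorem theorem12 (R : realType) :
  exists nu : nat -> R, (forall n, 0 < nu n) /\
  forall (n : nat), (0 < n)%N ->
  forall P : set 'rV[R]_n, integral_polyhedron P ->
  (exists z, is_int_point z /\ interior P z) ->
  exists (C : set 'rV[R]_n) (x : 'rV[R]_n),
    [/\ C `<=` P, convex_body C, centrally_symmetric C x,
        volume C = (nu n)%:E & C `&` @int_points R n = [set x]].
Proof.
have /choice[nu Hnu] (n : nat) : exists nu : R, 0 < nu /\ ((0 < n)%N ->
  forall P : set 'rV[R]_n, integral_polyhedron P ->
  (exists z, is_int_point z /\ interior P z) ->
  exists (C : set 'rV[R]_n) (x : 'rV[R]_n),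
    [/\ C `<=` P, convex_body C, centrally_symmetric C x,
        volume C = nu%:E & C `&` @int_points R n = [set x]]).
  (* In dimension 0 any positive value will do. *)
  have [n0|n0] := boolP (0 < n)%N; last by exists 1.
  by have [nu nu0 H] := @exists_symmetric_body R n n0; exists nu.
by exists nu; split => n; have [] := Hnu n.
Qed.
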